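(* Consider a node with two ingoing roads $1,2$ and one outgoing road $3$, with given boundary traces $\rho_B^1,\rho_B^2,\rho_B^3$. Starting from the fair merging kinetic coupling conditions (see context), the asymptotic derivation of the coupling conditions for the macroscopic equation $\partial_t\rho+\partial_xF(\rho)=0$ (kinetic layers at the node matched to half-Riemann problems, see context) gives the following cases for the fluxes $C^i$ and the new states $\rho_K^i$ at the node. The notation RP1/2-1/2-1/2 records the respective combination of half-Riemann problems on roads 1, 2, 3. **Case 1, RP1-1-1.** $\rho_B^1\ge\rho^\star,\ \rho_B^2\ge\rho^\star,\ \rho_B^3\le\rho^\star$. Then $C^1=C^2=\frac{\sigma}{2}$, $C^3=\sigma$ and $\rho_K^1=\rho_+(\frac{\sigma}{2})$, $\rho_K^2=\rho_+(\frac{\sigma}{2})$, $\rho_K^3=\rho^\star$. **Case 2, RP1-1-2.** $\rho_B^1\ge\rho^\star,\ \rho_B^2\ge\rho^\star,\ \rho_B^3\ge\rho^\star$. Then $C^1=C^2=\frac{F(\rho_B^3)}{2}$, $C^3=F(\rho_B^3)$ and $\rho_K^1=\rho_+(\frac{F(\rho_B^3)}{2})$, $\rho_K^2=\rho_+(\frac{F(\rho_B^3)}{2})$, $\rho_K^3=\rho_B^3$. **Case 3, RP1-2-1.** $\rho_B^1\ge\rho^\star,\ \rho_B^2\le\rho^\star,\ \rho_B^3\le\rho^\star$. Two subcases: - If $F(\rho_B^2)\ge\frac{\sigma}{2}$, then $C^1=C^2=\frac{\sigma}{2}$, $C^3=\sigma$ and $\rho_K^1=\rho_+(\frac{\sigma}{2})$,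 $\rho_K^2=\rho_+(\frac{\sigma}{2})$, $\rho_K^3=\rho^\star$. - If $F(\rho_B^2)\le\frac{\sigma}{2}$, then $C^1=\sigma-F(\rho_B^2)$, $C^2=F(\rho_B^2)$, $C^3=\sigma$ and $\rho_K^1=\rho_+(\sigma-F(\rho_B^2))$, $\rho_K^2=\rho_B^2$, $\rho_K^3=\rho^\star$. **Case 4, RP2-1-1** (symmetric to Case 3). $\rho_B^1\le\rho^\star,\ \rho_B^2\ge\rho^\star,\ \rho_B^3\le\rho^\star$. Two subcases: - If $F(\rho_B^1)\ge\frac{\sigma}{2}$, then $C^1=C^2=\frac{\sigma}{2}$, $C^3=\sigma$ and $\rho_K^1=\rho_+(\frac{\sigma}{2})$, $\rho_K^2=\rho_+(\frac{\sigma}{2})$, $\rho_K^3=\rho^\star$. - If $F(\rho_B^1)\le\frac{\sigma}{2}$, then $C^1=F(\rho_B^1)$, $C^2=\sigma-F(\rho_B^1)$, $C^3=\sigma$ and $\rho_K^1=\rho_B^1$, $\rho_K^2=\rho_+(\sigma-F(\rho_B^1))$, $\rho_K^3=\rho^\star$. **Case 5, RP1-2-2.** $\rho_B^1\ge\rho^\star,\ \rho_B^2\le\rho^\star,\ \rho_B^3\ge\rho^\star$. Two subcases: - If $F(\rho_B^3)\le 2F(\rho_B^2)$, then $C^1=C^2=\frac{F(\rho_B^3)}{2}$, $C^3=F(\rho_B^3)$ and $\rho_K^1=\rho_+(\frac{F(\rho_B^3)}{2})$, $\rho_K^2=\rho_+(\frac{F(\rho_B^3)}{2})$, $\rho_K^3=\rho_B^3$.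 - If $F(\rho_B^3)\ge 2F(\rho_B^2)$, then $C^1=F(\rho_B^3)-F(\rho_B^2)$, $C^2=F(\rho_B^2)$, $C^3=F(\rho_B^3)$ and $\rho_K^1=\rho_+(F(\rho_B^3)-F(\rho_B^2))$, $\rho_K^2=\rho_B^2$, $\rho_K^3=\rho_B^3$. **Case 6, RP2-1-2** (symmetric to Case 5). $\rho_B^1\le\rho^\star,\ \rho_B^2\ge\rho^\star,\ \rho_B^3\ge\rho^\star$. Two subcases: - If $F(\rho_B^3)\le 2F(\rho_B^1)$, then $C^1=C^2=\frac{F(\rho_B^3)}{2}$, $C^3=F(\rho_B^3)$ and $\rho_K^1=\rho_+(\frac{F(\rho_B^3)}{2})$, $\rho_K^2=\rho_+(\frac{F(\rho_B^3)}{2})$, $\rho_K^3=\rho_B^3$. - If $F(\rho_B^3)\ge 2F(\rho_B^1)$, then $C^1=F(\rho_B^1)$, $C^2=F(\rho_B^3)-F(\rho_B^1)$, $C^3=F(\rho_B^3)$ and $\rho_K^1=\rho_B^1$, $\rho_K^2=\rho_+(F(\rho_B^3)-F(\rho_B^1))$, $\rho_K^3=\rho_B^3$. **Case 7, RP2-2-1.** $\rho_B^1\le\rho^\star,\ \rho_B^2\le\rho^\star,\ \rho_B^3\le\rho^\star$. Four subcases: - If $F(\rho_B^1)+F(\rho_B^2)\le\sigma$, then $C^1=F(\rho_B^1)$, $C^2=F(\rho_B^2)$, $C^3=F(\rho_B^1)+F(\rho_B^2)$ and $\rho_K^1=\rho_B^1$, $\rho_K^2=\rho_B^2$, $\rho_K^3=\rho_-(F(\rho_B^1)+F(\rho_B^2))$.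 - If $F(\rho_B^1)+F(\rho_B^2)\ge\sigma$ and $F(\rho_B^1)\ge\frac{\sigma}{2}$, $F(\rho_B^2)\ge\frac{\sigma}{2}$, then $C^1=C^2=\frac{\sigma}{2}$, $C^3=\sigma$ and $\rho_K^1=\rho_+(\frac{\sigma}{2})$, $\rho_K^2=\rho_+(\frac{\sigma}{2})$, $\rho_K^3=\rho^\star$. - If $F(\rho_B^1)+F(\rho_B^2)\ge\sigma$ and $F(\rho_B^1)\ge\frac{\sigma}{2}$, $F(\rho_B^2)\le\frac{\sigma}{2}$, then $C^1=\sigma-F(\rho_B^2)$, $C^2=F(\rho_B^2)$, $C^3=\sigma$ and $\rho_K^1=\rho_+(\sigma-F(\rho_B^2))$, $\rho_K^2=\rho_B^2$, $\rho_K^3=\rho^\star$. - If $F(\rho_B^1)+F(\rho_B^2)\ge\sigma$ and $F(\rho_B^1)\le\frac{\sigma}{2}$, $F(\rho_B^2)\ge\frac{\sigma}{2}$, then $C^1=F(\rho_B^1)$, $C^2=\sigma-F(\rho_B^1)$, $C^3=\sigma$ and $\rho_K^1=\rho_B^1$, $\rho_K^2=\rho_+(\sigma-F(\rho_B^1))$, $\rho_K^3=\rho^\star$. **Case 8, RP2-2-2.** $\rho_B^1\le\rho^\star,\ \rho_B^2\le\rho^\star,\ \rho_B^3\ge\rho^\star$. Four subcases: - If $F(\rho_B^3)\le 2F(\rho_B^1)$ and $F(\rho_B^3)\le 2F(\rho_B^2)$, then $C^1=C^2=\frac{F(\rho_B^3)}{2}$, $C^3=F(\rho_B^3)$ and $\rho_K^1=\rho_+(\frac{F(\rho_B^3)}{2})$,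 $\rho_K^2=\rho_+(\frac{F(\rho_B^3)}{2})$, $\rho_K^3=\rho_B^3$. - If $F(\rho_B^3)\ge 2F(\rho_B^2)$ and $F(\rho_B^1)+F(\rho_B^2)\ge F(\rho_B^3)$, then $C^1=F(\rho_B^3)-F(\rho_B^2)$, $C^2=F(\rho_B^2)$, $C^3=F(\rho_B^3)$ and $\rho_K^1=\rho_+(F(\rho_B^3)-F(\rho_B^2))$, $\rho_K^2=\rho_B^2$, $\rho_K^3=\rho_B^3$. - If $F(\rho_B^3)\ge 2F(\rho_B^1)$ and $F(\rho_B^1)+F(\rho_B^2)\ge F(\rho_B^3)$, then $C^1=F(\rho_B^1)$, $C^2=F(\rho_B^3)-F(\rho_B^1)$, $C^3=F(\rho_B^3)$ and $\rho_K^1=\rho_B^1$, $\rho_K^2=\rho_+(F(\rho_B^3)-F(\rho_B^1))$, $\rho_K^3=\rho_B^3$. - If $F(\rho_B^1)+F(\rho_B^2)\le F(\rho_B^3)$, then $C^1=F(\rho_B^1)$, $C^2=F(\rho_B^2)$, $C^3=F(\rho_B^1)+F(\rho_B^2)$ and $\rho_K^1=\rho_B^1$, $\rho_K^2=\rho_B^2$, $\rho_K^3=\rho_-(F(\rho_B^1)+F(\rho_B^2))$.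
   Context: **Fundamental diagram.** $F:[0,1]\to[0,1]$ is smooth and strictly concave with $F(0)=0=F(1)$, $F'(\rho)\le 1$, and graph in the triangle $0\le\rho\le1$, $0\le q\le\rho$. Its maximum is attained at $\rho^\star$, and $\sigma=F(\rho^\star)$. For $0\le C\le\sigma$, $\rho_-(C)\le\rho^\star\le\rho_+(C)$ denote the solutions of $F(\rho)=C$ in $[0,\rho^\star]$ and $[\rho^\star,1]$; in particular $\rho_\pm(\sigma)=\rho^\star$, $\rho_-(0)=0$, $\rho_+(0)=1$. For $\rho\ne\rho^\star$, $\tau(\rho)\ne\rho$ is defined by $F(\tau(\rho))=F(\rho)$. **Kinetic model.** $f_0$ is the density of stopped cars (velocity 0) and $f_1$ the density of driving cars (velocity 1); $\rho=f_0+f_1\in[0,1]$ and $q=f_1$. On each road, with relaxation parameter $\epsilon>0$, $$\partial_t\rho+\partial_xq=0,\qquad \partial_tq+\frac{q}{1-\rho}\partial_x\rho+\Big(1-\frac{q}{1-\rho}\Big)\partial_xq=-\frac1\epsilon\,(q-F(\rho)).$$ The limit equation for $\epsilon\to0$ is $\partial_t\rho+\partial_xF(\rho)=0$. **Fair merging kinetic coupling conditions** (superscripts number the roads): $$1-f_0^1=1-f_0^3-f_1^2,\qquad 1-f_0^2=1-f_0^3-f_1^1,\qquad f_1^3=f_1^1+f_1^2,$$ equivalently $\rho^1=\rho^2=\rho^3$ and $q^3=q^1+q^2$ at the junction. **Asymptotic derivation.** The traces $\rho_B^i$ of the macroscopic solution at the node are given. On each road a kinetic layer is considered in the rescaled distance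 $y\in[0,\infty)$ from the node. In it the flux is a constant $C^i$, and the density satisfies $\partial_y\rho=(1-\rho)\frac{F(\rho)-C}{C}$ on the outgoing road 3 (node at the left boundary) and $-\partial_y\rho=(1-\rho)\frac{F(\rho)-C}{C}$ on the ingoing roads 1, 2 (node at the right boundary). Let $\rho_0^i$ be the layer density at $y=0$ and $\rho_K^i$ its asymptotic state at $y=\infty$. The values $\rho_0^i$, $C^i$ at the node are coupled by the kinetic coupling conditions: $\rho_0^1=\rho_0^2=\rho_0^3$, $C^3=C^1+C^2$. At the same time $\rho_K^i$ is the right (roads 1, 2) or left (road 3) state of a half-Riemann problem for the limit equation, with $\rho_B^i$ as the corresponding left (roads 1, 2) or right (road 3) state. For each of the eight combinations of half-Riemann problems, all combinations of unstable (U) and stable (S) layer solutions are examined and those that are not admissible are discarded; this determines $C^i$ and $\rho_K^i$. *Layer conditions, outgoing road (left boundary).* - (U): $\rho_K=\rho_-(C)$, $\rho_0=\rho_-(C)$, $0\le C<\sigma$. - (S): $\rho_K=\rho_+(C)$, $\rho_0\in(\rho_-(C),1)$ for $0<C<\sigma$; $\rho_K=\rho^\star$, $\rho_0\in[\rho^\star,1)$ for $C=\sigma$; $\rho_K=1$, $\rho_0\in(0,1]$ for $C=0$. *Layer conditions, ingoing roads (right boundary).* - (U): $\rho_K=\rho_+(C)$, $\rho_0=\rho_+(C)$, $0\le C<\sigma$. - (S): $\rho_K=\rho_-(C)$, $\rho_0\in[0,\rho_+(C))$ for $0<C<\sigma$; $\rho_K=\rho^\star$, $\rho_0\in[0,\rho^\star]$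 for $C=\sigma$; $\rho_K=0$, $\rho_0\in[0,1)$ for $C=0$. *Half-Riemann conditions, outgoing road.* RP1: $\rho_B\le\rho^\star$, then $\rho_K\in[0,\rho^\star]$. RP2: $\rho_B>\rho^\star$, then $\rho_K\in[0,\tau(\rho_B)]\cup\{\rho_B\}$. *Half-Riemann conditions, ingoing roads.* RP1: $\rho_B\ge\rho^\star$, then $\rho_K\in[\rho^\star,1]$. RP2: $\rho_B<\rho^\star$, then $\rho_K\in\{\rho_B\}\cup[\tau(\rho_B),1]$.
   Formalization: Where subcases overlap with equality they prescribe different states; there only existence, the fluxes C^i and the values F(ρ_K^i) are asserted: ρ_K is not claimed unique if F(ρ_B^1)+F(ρ_B^2) equals σ or F(ρ_B^3), nor admissible for ρ_K^i=ρ_B^i if F(ρ_B^i) equals σ/2 or F(ρ_B^3)/2. *)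

(* Defs.v *)
From Stdlib Require Import Reals ClassicalEpsilon.
From Coquelicot Require Import Coquelicot.
Open Scope R_scope.

Definition in01 (x : R) : Prop := 0 <= x <= 1.

(* Only the values of [F] on [0,1] matter.  Smoothness on the closed interval
   is the existence of a smooth extension [G]; at the endpoints [Derive G] is
   the one-sided derivative of [F].  The last field also says that [F] maps
   [0,1] to itself. *)
Record fundamental_diagram (F : R -> R) : Prop := {
  fd_smooth : exists G : R -> R,
    (forall (n : nat) (x : R), ex_derive_n G n x) /\
    (forall x, in01 x -> G x = F x /\ Derive G x <= 1);
  fd_strictly_concave : forall x y t,
    in01 x -> in01 y -> x <> y -> 0 < t < 1 ->
    t * F x + (1 - t) * F y < F (t * x + (1 - t) * y);
  fd_zero : F 0 = 0;
  fd_one : F 1 = 0;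
  fd_triangle : forall x, in01 x -> 0 <= F x <= x
}.

(* The points below are chosen by [epsilon]; for a fundamental diagram the
   defining property has exactly one solution on the stated range. *)
Definition the (P : R -> Prop) : R := epsilon (inhabits 0) P.

Definition rho_star (F : R -> R) : R :=
  the (fun r => in01 r /\ forall x, in01 x -> F x <= F r).

Definition flux_max (F : R -> R) : R := F (rho_star F).

(* Meaningful for 0 <= C <= flux_max F. *)
Definition rho_minus (F : R -> R) (C : R) : R :=
  the (fun r => 0 <= r <= rho_star F /\ F r = C).

Definition rho_plus (F : R -> R) (C : R) : R :=
  the (fun r => rho_star F <= r <= 1 /\ F r = C).

(* Meaningful for r in [0,1] different from rho_star F. *)
Definition tau (F : R -> R) (r : R) : R :=
  the (fun s => in01 s /\ s <> r /\ F s = F r).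

(* Layer conditions: [C] is the flux in the layer, [rK] the asymptotic state,
   [r0] the density at the node. *)

Definition layer_out_U (F : R -> R) (C rK r0 : R) : Prop :=
  0 <= C < flux_max F /\ rK = rho_minus F C /\ r0 = rho_minus F C.

Definition layer_out_S (F : R -> R) (C rK r0 : R) : Prop :=
  (0 < C < flux_max F /\ rK = rho_plus F C /\ rho_minus F C < r0 < 1) \/
  (C = flux_max F /\ rK = rho_star F /\ rho_star F <= r0 < 1) \/
  (C = 0 /\ rK = 1 /\ 0 < r0 <= 1).

Definition layer_in_U (F : R -> R) (C rK r0 : R) : Prop :=
  0 <= C < flux_max F /\ rK = rho_plus F C /\ r0 = rho_plus F C.

Definition layer_in_S (F : R -> R) (C rK r0 : R) : Prop :=
  (0 < C < flux_max F /\ rK = rho_minus F C /\ 0 <= r0 < rho_plus F C) \/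
  (C = flux_max F /\ rK = rho_star F /\ 0 <= r0 <= rho_star F) \/
  (C = 0 /\ rK = 0 /\ 0 <= r0 < 1).

Definition layer_out (F : R -> R) (C rK r0 : R) : Prop :=
  layer_out_U F C rK r0 \/ layer_out_S F C rK r0.

Definition layer_in (F : R -> R) (C rK r0 : R) : Prop :=
  layer_in_U F C rK r0 \/ layer_in_S F C rK r0.

(* Half-Riemann conditions; the first disjunct is RP1, the second RP2. *)

Definition half_riemann_out (F : R -> R) (rB rK : R) : Prop :=
  (rB <= rho_star F /\ 0 <= rK <= rho_star F) \/
  (rho_star F < rB /\ (0 <= rK <= tau F rB \/ rK = rB)).

Definition half_riemann_in (F : R -> R) (rB rK : R) : Prop :=
  (rho_star F <= rB /\ rho_star F <= rK <= 1) \/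
  (rB < rho_star F /\ (rK = rB \/ tau F rB <= rK <= 1)).

(* One value per road; roads 1 and 2 are ingoing, road 3 is outgoing. *)
Record roads : Type := Roads { road1 : R; road2 : R; road3 : R }.

(* Fair merging conditions on the densities of stopped cars [f0] and of
   driving cars [f1] at the node. *)
Definition fair_merging (f0 f1 : roads) : Prop :=
  1 - road1 f0 = 1 - road3 f0 - road2 f1 /\
  1 - road2 f0 = 1 - road3 f0 - road1 f1 /\
  road3 f1 = road1 f1 + road2 f1.

(* [B]: given traces, [C]: fluxes, [K]: new states.  The kinetic state at the
   node has density r0 = f0 + f1 and flux C = f1. *)
Definition admissible (F : R -> R) (B C K : roads) : Prop :=
  exists r0 : roads,
    fair_merging
      (Roads (road1 r0 - road1 C) (road2 r0 - road2 C) (road3 r0 - road3 C)) C /\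
    (layer_in F (road1 C) (road1 K) (road1 r0) /\
     half_riemann_in F (road1 B) (road1 K)) /\
    (layer_in F (road2 C) (road2 K) (road2 r0) /\
     half_riemann_in F (road2 B) (road2 K)) /\
    (layer_out F (road3 C) (road3 K) (road3 r0) /\
     half_riemann_out F (road3 B) (road3 K)).

Definition determined (F : R -> R) (B C K : roads) : Prop :=
  forall C' K', admissible F B C' K' <-> C' = C /\ K' = K.

(* When the conditions of two subcases hold simultaneously, with equality, the
   subcases prescribe the same fluxes but states K that may differ by a
   standing shock, so not all of them can be the unique admissible state.
   [lost] is the equality at which the prescribed K is not admissible: there an
   ingoing (S) layer would need r0 = rho_plus F C, which is excluded.
   [multiple] is the equality at which the prescribed K is admissible but need
   not be the only admissible state.  The fluxes, and the states up to a
   standing shock, are determined without exception. *)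
Definition determined_up_to_ties
    (F : R -> R) (B : roads) (lost multiple : Prop) (C K : roads) : Prop :=
  (exists K', admissible F B C K') /\
  (forall C' K', admissible F B C' K' ->
     C' = C /\ F (road1 K') = F (road1 K) /\ F (road2 K') = F (road2 K) /\
     F (road3 K') = F (road3 K)) /\
  (~ lost -> admissible F B C K) /\
  (~ lost -> ~ multiple -> determined F B C K).

(* Main.v *)
Require Import Defs.
From Stdlib Require Import Reals Lra Classical ClassicalEpsilon.
From Coquelicot Require Import Coquelicot.
Open Scope R_scope.

(** Fair merging forces the three node densities to agree: the road-wise
    conditions on [f0] and [f1] say exactly that there is one density [r] at
    the node and that the flux is conserved.  On a single road, the layer and
    half-Riemann conditions together then leave no freedom once [r] is chosen:
    with demand D (F before its maximum, the capacity after it) and supply S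
    (the capacity before the maximum, F after it), the flux must be the
    Godunov flux min(D(u), S(v)), where u and v are the trace and the node
    density in driving order ([ingoing_road], [outgoing_road]).  So admissibility
    amounts to one scalar equation for [r],
<<
      min(D(b1), S(r)) + min(D(b2), S(r)) = min(D(r), S(b3)),
>>
    and the fluxes and states are explicit functions of its solution
    ([admissible_iff_balanced]).

    The left side is nonincreasing and the right side nondecreasing in [r].
    Hence every term is constant on the set of solutions, which makes the
    fluxes unique ([balanced_fluxes_unique]).  The solution [r] itself can fail
    to be unique only when D(b1) + D(b2) = S(b3) with both demands below
    capacity ([balanced_unique]); there the admissible states may differ by a
    standing shock.

    It remains to exhibit a solution.  With D1, D2, S3 the demands and the
    supply of the traces, the eight cases collapse to three regimes: the supply
    is split equally (S3/2 is at most D1 and D2), one road sends all its demand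
    and the other one the remaining supply (up to symmetry, 2 D2 <= S3 <=
    D1 + D2), or both roads send all their demand (D1 + D2 <= S3). *)

(** * The fundamental diagram and its two inverse branches *)

Lemma the_spec (P : R -> Prop) : (exists r, P r) -> P (the P).
Proof. exact (epsilon_spec (inhabits 0) P). Qed.

Lemma smooth_extension_continuous (F : R -> R) (HF : fundamental_diagram F) :
  exists G : R -> R, continuity G /\ forall x, in01 x -> G x = F x.
Proof.
  destruct (fd_smooth F HF) as [G [HG HGF]].
  exists G; split; [| intros x Hx; exact (proj1 (HGF x Hx))].
  intros x. apply derivable_continuous_pt, ex_derive_Reals_0. exact (HG 1%nat x).
Qed.

Lemma rho_star_spec (F : R -> R) (HF : fundamental_diagram F) :
  in01 (rho_star F) /\ forall x, in01 x -> F x <= flux_max F.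
Proof.
  apply (the_spec (fun r => in01 r /\ forall x, in01 x -> F x <= F r)).
  destruct (smooth_extension_continuous F HF) as [G [HG HGF]].
  destruct (continuity_ab_maj G 0 1) as [m [Hm Hm01]]; [lra | auto |].
  exists m; split; [exact Hm01 |].
  intros x Hx. rewrite <- (HGF x Hx), <- (HGF m Hm01). auto.
Qed.

Lemma flux_max_pos (F : R -> R) (HF : fundamental_diagram F) : 0 < flux_max F.
Proof.
  pose proof (fd_strictly_concave F HF 0 1 (1/2)) as H.
  unfold in01 in H. rewrite (fd_zero F HF), (fd_one F HF) in H.
  pose proof (proj2 (rho_star_spec F HF) (1/2 * 0 + (1 - 1/2) * 1)) as Hle.
  unfold in01 in Hle. lra.
Qed.

(** Two maximisers would be beaten by their midpoint, by strict concavity. *)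
Lemma flux_lt_max (F : R -> R) (HF : fundamental_diagram F) (x : R) :
  in01 x -> x <> rho_star F -> F x < flux_max F.
Proof.
  intros Hx Hne. destruct (rho_star_spec F HF) as [Hs Hmax].
  destruct (Hmax x Hx) as [Hlt | Heq]; [exact Hlt | exfalso].
  pose proof (fd_strictly_concave F HF x (rho_star F) (1/2) Hx Hs Hne) as Hc.
  assert (Hm : in01 (1/2 * x + (1 - 1/2) * rho_star F)) by (unfold in01 in *; lra).
  pose proof (Hmax _ Hm). unfold flux_max in *. lra.
Qed.

Lemma rho_star_interior (F : R -> R) (HF : fundamental_diagram F) :
  0 < rho_star F < 1.
Proof.
  destruct (rho_star_spec F HF) as [[H0 H1] _].
  pose proof (flux_max_pos F HF) as Hp. unfold flux_max in Hp.
  split.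
  - destruct H0 as [H | H]; [exact H |]. rewrite <- H, (fd_zero F HF) in Hp. lra.
  - destruct H1 as [H | H]; [exact H |]. rewrite H, (fd_one F HF) in Hp. lra.
Qed.

(** Strict concavity with the maximiser as second point: moving towards
    [rho_star] increases the flux from either side, so both monotonicity lemmas
    below come from this one. *)
Lemma flux_lt_toward_max (F : R -> R) (HF : fundamental_diagram F) (x t : R) :
  in01 x -> x <> rho_star F -> 0 <= t < 1 ->
  F x < F (t * x + (1 - t) * rho_star F).
Proof.
  intros Hx Hne Ht. pose proof (flux_lt_max F HF x Hx Hne) as Hlt.
  destruct (Req_dec t 0) as [-> | Ht0].
  - replace (0 * x + (1 - 0) * rho_star F) with (rho_star F) by ring. exact Hlt.
  - pose proof (fd_strictly_concave F HF x (rho_star F) t Hx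
      (proj1 (rho_star_spec F HF)) Hne) as Hc.
    unfold flux_max in Hlt. nra.
Qed.

Lemma flux_increasing (F : R -> R) (HF : fundamental_diagram F) (x y : R) :
  0 <= x -> x < y -> y <= rho_star F -> F x < F y.
Proof.
  intros Hx Hxy Hy. pose proof (rho_star_interior F HF).
  assert (0 < / (rho_star F - x)) by (apply Rinv_0_lt_compat; lra).
  replace y with
    ((rho_star F - y) / (rho_star F - x) * x
     + (1 - (rho_star F - y) / (rho_star F - x)) * rho_star F) by (field; lra).
  apply flux_lt_toward_max; unfold in01; [assumption | lra | lra |].
  split.
  - apply Rdiv_le_0_compat; lra.
  - apply Rlt_div_l; lra.
Qed.

Lemma flux_decreasing (F : R -> R) (HF : fundamental_diagram F) (x y : R) :
  rho_star F <= x -> x < y -> y <= 1 -> F y < F x.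
Proof.
  intros Hx Hxy Hy. pose proof (rho_star_interior F HF).
  replace x with
    ((x - rho_star F) / (y - rho_star F) * y
     + (1 - (x - rho_star F) / (y - rho_star F)) * rho_star F) by (field; lra).
  apply flux_lt_toward_max; unfold in01; [assumption | lra | lra |].
  split.
  - apply Rdiv_le_0_compat; lra.
  - apply Rlt_div_l; lra.
Qed.

Lemma flux_level (F : R -> R) (HF : fundamental_diagram F) (a b C : R) :
  0 <= a <= b -> b <= 1 -> Rmin (F a) (F b) <= C <= Rmax (F a) (F b) ->
  exists r, a <= r <= b /\ F r = C.
Proof.
  intros Ha Hb HC.
  destruct (smooth_extension_continuous F HF) as [G [HG HGF]].
  rewrite <- (HGF a), <- (HGF b) in HC by (unfold in01; lra).
  destruct (IVT_gen G a b C HG HC) as [r [Hr Hrc]].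
  rewrite Rmin_left, Rmax_right in Hr by lra.
  exists r; split; [exact Hr |].
  rewrite <- (HGF r); [exact Hrc | unfold in01; lra].
Qed.

Lemma rho_minus_spec (F : R -> R) (HF : fundamental_diagram F) (C : R) :
  0 <= C <= flux_max F ->
  0 <= rho_minus F C <= rho_star F /\ F (rho_minus F C) = C.
Proof.
  intros HC. pose proof (rho_star_interior F HF).
  apply (the_spec (fun r => 0 <= r <= rho_star F /\ F r = C)).
  apply (flux_level F HF); [lra | lra |]. unfold flux_max in HC.
  rewrite (fd_zero F HF), Rmin_left, Rmax_right; lra.
Qed.

Lemma rho_plus_spec (F : R -> R) (HF : fundamental_diagram F) (C : R) :
  0 <= C <= flux_max F ->
  rho_star F <= rho_plus F C <= 1 /\ F (rho_plus F C) = C.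
Proof.
  intros HC. pose proof (rho_star_interior F HF).
  apply (the_spec (fun r => rho_star F <= r <= 1 /\ F r = C)).
  apply (flux_level F HF); [lra | lra |]. unfold flux_max in HC.
  rewrite (fd_one F HF), Rmin_right, Rmax_left; lra.
Qed.

Lemma flux_range (F : R -> R) (HF : fundamental_diagram F) (x : R) :
  in01 x -> 0 <= F x <= flux_max F.
Proof.
  intros Hx. split; [apply (fd_triangle F HF x Hx) | apply (rho_star_spec F HF), Hx].
Qed.

Lemma flux_inj_left (F : R -> R) (HF : fundamental_diagram F) (x y : R) :
  0 <= x <= rho_star F -> 0 <= y <= rho_star F -> F x = F y -> x = y.
Proof.
  intros Hx Hy E. destruct (Rtotal_order x y) as [H | [H | H]]; [| exact H |].
  - pose proof (flux_increasing F HF x y). lra.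
  - pose proof (flux_increasing F HF y x). lra.
Qed.

Lemma flux_inj_right (F : R -> R) (HF : fundamental_diagram F) (x y : R) :
  rho_star F <= x <= 1 -> rho_star F <= y <= 1 -> F x = F y -> x = y.
Proof.
  intros Hx Hy E. destruct (Rtotal_order x y) as [H | [H | H]]; [| exact H |].
  - pose proof (flux_decreasing F HF x y). lra.
  - pose proof (flux_decreasing F HF y x). lra.
Qed.

Lemma rho_minus_flux (F : R -> R) (HF : fundamental_diagram F) (b : R) :
  0 <= b <= rho_star F -> rho_minus F (F b) = b.
Proof.
  intros Hb. pose proof (rho_star_interior F HF).
  destruct (rho_minus_spec F HF (F b)) as [Hr E].
  - apply (flux_range F HF). unfold in01; lra.
  - apply (flux_inj_left F HF); assumption.
Qed.

Lemma rho_plus_flux (F : R -> R) (HF : fundamental_diagram F) (b : R) :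
  rho_star F <= b <= 1 -> rho_plus F (F b) = b.
Proof.
  intros Hb. pose proof (rho_star_interior F HF).
  destruct (rho_plus_spec F HF (F b)) as [Hr E].
  - apply (flux_range F HF). unfold in01; lra.
  - apply (flux_inj_right F HF); assumption.
Qed.

Lemma rho_minus_max (F : R -> R) (HF : fundamental_diagram F) :
  rho_minus F (flux_max F) = rho_star F.
Proof. pose proof (rho_star_interior F HF). apply (rho_minus_flux F HF). lra. Qed.

Lemma rho_plus_max (F : R -> R) (HF : fundamental_diagram F) :
  rho_plus F (flux_max F) = rho_star F.
Proof. pose proof (rho_star_interior F HF). apply (rho_plus_flux F HF). lra. Qed.

(** Strict monotonicity on each branch leaves the opposite branch as the only
    place for another density with the same flux. *)
Lemma tau_left (F : R -> R) (HF : fundamental_diagram F) (b : R) :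
  0 <= b < rho_star F -> tau F b = rho_plus F (F b).
Proof.
  intros Hb. pose proof (rho_star_interior F HF).
  assert (Hb01 : in01 b) by (unfold in01; lra).
  destruct (rho_plus_spec F HF (F b) (flux_range F HF b Hb01)) as [Hr E].
  destruct (the_spec (fun s => in01 s /\ s <> b /\ F s = F b)) as [Ht [Hne Et]].
  { exists (rho_plus F (F b)). unfold in01; repeat split; lra. }
  fold (tau F b) in *. unfold in01 in Ht.
  destruct (Rle_dec (tau F b) (rho_star F)).
  - elim Hne. apply (flux_inj_left F HF); lra.
  - apply (flux_inj_right F HF); lra.
Qed.

Lemma tau_right (F : R -> R) (HF : fundamental_diagram F) (b : R) :
  rho_star F < b <= 1 -> tau F b = rho_minus F (F b).
Proof.
  intros Hb. pose proof (rho_star_interior F HF).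
  assert (Hb01 : in01 b) by (unfold in01; lra).
  destruct (rho_minus_spec F HF (F b) (flux_range F HF b Hb01)) as [Hr E].
  destruct (the_spec (fun s => in01 s /\ s <> b /\ F s = F b)) as [Ht [Hne Et]].
  { exists (rho_minus F (F b)). unfold in01; repeat split; lra. }
  fold (tau F b) in *. unfold in01 in Ht.
  destruct (Rle_dec (tau F b) (rho_star F)).
  - apply (flux_inj_left F HF); lra.
  - elim Hne. apply (flux_inj_right F HF); lra.
Qed.

(** * Demand and supply *)

Definition demand (F : R -> R) (r : R) : R :=
  if Rlt_dec r (rho_star F) then F r else flux_max F.

Definition supply (F : R -> R) (r : R) : R :=
  if Rle_dec r (rho_star F) then flux_max F else F r.

Lemma demand_left (F : R -> R) (r : R) : r <= rho_star F -> demand F r = F r.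
Proof.
  intros Hr. unfold demand, flux_max. destruct (Rlt_dec r (rho_star F)); [reflexivity |].
  f_equal; lra.
Qed.

Lemma demand_right (F : R -> R) (r : R) : rho_star F <= r -> demand F r = flux_max F.
Proof. intros Hr. unfold demand. destruct (Rlt_dec r (rho_star F)); lra. Qed.

Lemma supply_left (F : R -> R) (r : R) : r <= rho_star F -> supply F r = flux_max F.
Proof. intros Hr. unfold supply. destruct (Rle_dec r (rho_star F)); lra. Qed.

Lemma supply_right (F : R -> R) (r : R) : rho_star F <= r -> supply F r = F r.
Proof.
  intros Hr. unfold supply, flux_max. destruct (Rle_dec r (rho_star F)); [| reflexivity].
  f_equal; lra.
Qed.

Lemma demand_range (F : R -> R) (HF : fundamental_diagram F) (r : R) :
  in01 r -> 0 <= demand F r <= flux_max F.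
Proof.
  intros Hr. pose proof (flux_range F HF r Hr).
  unfold demand. destruct (Rlt_dec r (rho_star F)); lra.
Qed.

Lemma supply_range (F : R -> R) (HF : fundamental_diagram F) (r : R) :
  in01 r -> 0 <= supply F r <= flux_max F.
Proof.
  intros Hr. pose proof (flux_range F HF r Hr).
  unfold supply. destruct (Rle_dec r (rho_star F)); lra.
Qed.

Lemma demand_lt (F : R -> R) (HF : fundamental_diagram F) (x y : R) :
  in01 x -> in01 y -> x < y -> x < rho_star F -> demand F x < demand F y.
Proof.
  intros Hx Hy Hxy Hlt. rewrite (demand_left F x) by lra.
  unfold demand. destruct (Rlt_dec y (rho_star F)).
  - apply (flux_increasing F HF); unfold in01 in *; lra.
  - apply (flux_lt_max F HF); [exact Hx | lra].
Qed.

Lemma supply_lt (F : R -> R) (HF : fundamental_diagram F) (x y : R) :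
  in01 x -> in01 y -> x < y -> rho_star F < y -> supply F y < supply F x.
Proof.
  intros Hx Hy Hxy Hlt. rewrite (supply_right F y) by lra.
  unfold supply. destruct (Rle_dec x (rho_star F)).
  - apply (flux_lt_max F HF); [exact Hy | lra].
  - apply (flux_decreasing F HF); unfold in01 in *; lra.
Qed.

Lemma demand_le (F : R -> R) (HF : fundamental_diagram F) (x y : R) :
  in01 x -> in01 y -> x <= y -> demand F x <= demand F y.
Proof.
  intros Hx Hy Hxy. destruct (Rlt_dec x (rho_star F)).
  - destruct Hxy as [Hxy | ->]; [left; apply (demand_lt F HF); assumption | lra].
  - rewrite !demand_right; lra.
Qed.

Lemma supply_le (F : R -> R) (HF : fundamental_diagram F) (x y : R) :
  in01 x -> in01 y -> x <= y -> supply F y <= supply F x.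
Proof.
  intros Hx Hy Hxy. destruct (Rlt_dec (rho_star F) y).
  - destruct Hxy as [Hxy | ->]; [left; apply (supply_lt F HF); assumption | lra].
  - rewrite !supply_left; lra.
Qed.

Lemma rho_minus_in01 (F : R -> R) (HF : fundamental_diagram F) (C : R) :
  0 <= C <= flux_max F -> in01 (rho_minus F C).
Proof.
  intros HC. pose proof (rho_star_interior F HF).
  pose proof (rho_minus_spec F HF C HC). unfold in01; lra.
Qed.

Lemma rho_plus_in01 (F : R -> R) (HF : fundamental_diagram F) (C : R) :
  0 <= C <= flux_max F -> in01 (rho_plus F C).
Proof.
  intros HC. pose proof (rho_star_interior F HF).
  pose proof (rho_plus_spec F HF C HC). unfold in01; lra.
Qed.

Lemma demand_rho_minus (F : R -> R) (HF : fundamental_diagram F) (C : R) :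
  0 <= C <= flux_max F -> demand F (rho_minus F C) = C.
Proof.
  intros HC. destruct (rho_minus_spec F HF C HC) as [Hr E].
  rewrite demand_left; lra.
Qed.

Lemma supply_rho_plus (F : R -> R) (HF : fundamental_diagram F) (C : R) :
  0 <= C <= flux_max F -> supply F (rho_plus F C) = C.
Proof.
  intros HC. destruct (rho_plus_spec F HF C HC) as [Hr E].
  rewrite supply_right; lra.
Qed.

(** * Layers in terms of demand and supply *)

(** An ingoing layer carries at most the supply of the node density, and its
    unstable and stable solutions differ by whether that bound is attained.
    At C = [flux_max F] the stable branch belongs to the first alternative,
    since both inverses of F equal [rho_star] there. *)
Lemma layer_in_iff (F : R -> R) (HF : fundamental_diagram F) (C K r : R) :
  layer_in F C K r <->
  in01 r /\ 0 <= C <= flux_max F /\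
  ((C = supply F r /\ K = rho_plus F C) \/ (C < supply F r /\ K = rho_minus F C)).
Proof.
  pose proof (rho_star_interior F HF) as Hs.
  pose proof (flux_max_pos F HF) as Hm.
  assert (Hm0 : rho_minus F 0 = 0).
  { rewrite <- (fd_zero F HF) at 1. apply (rho_minus_flux F HF); lra. }
  split.
  - intros [[HC [-> ->]] | [[HC [-> Hr]] | [[-> [-> Hr]] | [-> [-> Hr]]]]].
    + assert (HC' : 0 <= C <= flux_max F) by lra.
      split; [apply (rho_plus_in01 F HF); lra |]. split; [lra |]. left.
      now rewrite supply_rho_plus.
    + assert (HC' : 0 <= C <= flux_max F) by lra.
      destruct (rho_plus_spec F HF C HC') as [Hp E].
      assert (rho_plus F C <> rho_star F)
        by (intros E'; rewrite E' in E; unfold flux_max in HC; lra).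
      assert (Hr01 : in01 r) by (unfold in01; lra).
      split; [exact Hr01 |]. split; [lra |]. right. split; [| reflexivity].
      rewrite <- (supply_rho_plus F HF C HC') at 1.
      apply (supply_lt F HF);
        [exact Hr01 | apply (rho_plus_in01 F HF); lra | lra | lra].
    + split; [unfold in01; lra |]. split; [lra |]. left.
      now rewrite supply_left, rho_plus_max by (assumption || lra).
    + split; [unfold in01; lra |]. split; [lra |]. right. rewrite Hm0.
      split; [| reflexivity].
      rewrite <- (fd_one F HF), <- (supply_right F 1) by lra.
      apply (supply_lt F HF); unfold in01; lra.
  - intros [Hr [HC [[E ->] | [Hlt ->]]]].
    + destruct (Rle_dec r (rho_star F)) as [Hle | Hgt].
      * rewrite supply_left in E by assumption. subst C.
        right; right; left. rewrite rho_plus_max by assumption.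
        unfold in01 in Hr. repeat split; lra.
      * rewrite supply_right in E by lra.
        assert (F r < flux_max F) by (apply (flux_lt_max F HF); [assumption | lra]).
        left. split; [lra |]. split; [reflexivity |].
        subst C. symmetry. apply (rho_plus_flux F HF). unfold in01 in Hr; lra.
    + pose proof (supply_range F HF r Hr) as Hsr.
      destruct (Req_dec C 0) as [-> | HC0].
      * right; right; right. split; [reflexivity |]. split; [exact Hm0 |].
        assert (r <> 1)
          by (intros ->; rewrite supply_right, (fd_one F HF) in Hlt; lra).
        unfold in01 in Hr; lra.
      * right; left. split; [lra |]. split; [reflexivity |].
        split; [unfold in01 in Hr; lra |]. apply Rnot_le_lt. intros Hle.
        apply (supply_le F HF) in Hle; [| apply (rho_plus_in01 F HF); lra | exact Hr].
        rewrite supply_rho_plus in Hle by assumption. lra.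
Qed.

(** The mirror image of [layer_in_iff], except for the node density 1, which the
    stable layer allows only for vanishing flux. *)
Lemma layer_out_iff (F : R -> R) (HF : fundamental_diagram F) (C K r : R) :
  layer_out F C K r <->
  in01 r /\ 0 <= C <= flux_max F /\ (r < 1 \/ C = 0) /\
  ((C = demand F r /\ K = rho_minus F C) \/ (C < demand F r /\ K = rho_plus F C)).
Proof.
  pose proof (rho_star_interior F HF) as Hs.
  pose proof (flux_max_pos F HF) as Hm.
  assert (Hp0 : rho_plus F 0 = 1).
  { rewrite <- (fd_one F HF) at 1. apply (rho_plus_flux F HF); lra. }
  split.
  - intros [[HC [-> ->]] | [[HC [-> Hr]] | [[-> [-> Hr]] | [-> [-> Hr]]]]].
    + assert (HC' : 0 <= C <= flux_max F) by lra.
      pose proof (rho_minus_spec F HF C HC').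
      split; [apply (rho_minus_in01 F HF); lra |]. split; [lra |].
      split; [lra |]. left. now rewrite demand_rho_minus.
    + assert (HC' : 0 <= C <= flux_max F) by lra.
      destruct (rho_minus_spec F HF C HC') as [Hp E].
      assert (rho_minus F C <> rho_star F)
        by (intros E'; rewrite E' in E; unfold flux_max in HC; lra).
      assert (Hr01 : in01 r) by (unfold in01; lra).
      split; [exact Hr01 |]. split; [lra |]. split; [lra |].
      right. split; [| reflexivity].
      rewrite <- (demand_rho_minus F HF C HC') at 1.
      apply (demand_lt F HF);
        [apply (rho_minus_in01 F HF); lra | exact Hr01 | lra | lra].
    + split; [unfold in01; lra |]. split; [lra |]. split; [lra |]. left.
      now rewrite demand_right, rho_minus_max by (assumption || lra).
    + split; [unfold in01; lra |]. split; [lra |]. split; [lra |].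
      right. rewrite Hp0. split; [| reflexivity].
      rewrite <- (fd_zero F HF), <- (demand_left F 0) by lra.
      apply (demand_lt F HF); unfold in01; lra.
  - intros [Hr [HC [Hr1 [[E ->] | [Hlt ->]]]]].
    + destruct (Rlt_dec r (rho_star F)) as [Hlt | Hge].
      * rewrite demand_left in E by lra.
        assert (F r < flux_max F) by (apply (flux_lt_max F HF); [assumption | lra]).
        left. split; [lra |]. split; [reflexivity |].
        subst C. symmetry. apply (rho_minus_flux F HF). unfold in01 in Hr; lra.
      * rewrite demand_right in E by lra. subst C.
        right; right; left. rewrite rho_minus_max by assumption.
        unfold in01 in Hr. repeat split; lra.
    + pose proof (demand_range F HF r Hr) as Hdr.
      destruct (Req_dec C 0) as [-> | HC0].
      * right; right; right. split; [reflexivity |]. split; [exact Hp0 |].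
        assert (r <> 0)
          by (intros ->; rewrite demand_left, (fd_zero F HF) in Hlt; lra).
        unfold in01 in Hr; lra.
      * right; left. split; [lra |]. split; [reflexivity |].
        split; [| lra]. apply Rnot_le_lt. intros Hle.
        apply (demand_le F HF) in Hle; [| exact Hr | apply (rho_minus_in01 F HF); lra].
        rewrite demand_rho_minus in Hle by assumption. lra.
Qed.

(** * Half-Riemann problems in terms of demand and supply *)

(** A congested state is reached by a wave leaving the node exactly when its
    flux does not exceed what the trace wants to send. *)
Lemma half_riemann_in_rho_plus (F : R -> R) (HF : fundamental_diagram F) (b C : R) :
  in01 b -> 0 <= C <= flux_max F ->
  half_riemann_in F b (rho_plus F C) <-> C <= demand F b.
Proof.
  intros Hb HC. pose proof (rho_star_interior F HF) as Hs.
  destruct (rho_plus_spec F HF C HC) as [Hr E].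
  unfold half_riemann_in. destruct (Rlt_dec b (rho_star F)) as [Hlt | Hge].
  - rewrite demand_left, (tau_left F HF) by (unfold in01 in Hb; lra).
    pose proof (flux_range F HF b Hb) as HFb.
    split.
    + intros [[H _] | [_ [H | [H _]]]]; [lra | lra |].
      apply (supply_le F HF) in H; try (apply (rho_plus_in01 F HF); assumption).
      now rewrite !supply_rho_plus in H.
    + intros Hle. right. split; [assumption |]. right. split; [| lra].
      apply Rnot_lt_le. intros H.
      pose proof (supply_lt F HF _ _ (rho_plus_in01 F HF C HC)
        (rho_plus_in01 F HF _ HFb) H) as Hlt'.
      rewrite !supply_rho_plus in Hlt' by assumption. lra.
  - rewrite demand_right by lra. split; intros _; [lra | left; lra].
Qed.

(** A strictly free state cannot be connected to an ingoing trace by a wave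
    moving away from the node, so it has to be the trace itself. *)
Lemma half_riemann_in_rho_minus (F : R -> R) (HF : fundamental_diagram F) (b C : R) :
  in01 b -> 0 <= C < flux_max F ->
  half_riemann_in F b (rho_minus F C) <-> C = demand F b /\ rho_minus F C = b.
Proof.
  intros Hb HC. pose proof (rho_star_interior F HF) as Hs.
  destruct (rho_minus_spec F HF C) as [Hr E]; [lra |].
  assert (rho_minus F C <> rho_star F)
    by (intros E'; rewrite E' in E; unfold flux_max in HC; lra).
  unfold half_riemann_in. split.
  - intros [H0 | [Hlt [Eb | Ht]]]; [lra | |].
    + rewrite demand_left by lra. split; [rewrite <- Eb; lra | exact Eb].
    + rewrite (tau_left F HF) in Ht by (unfold in01 in Hb; lra).
      pose proof (rho_plus_spec F HF _ (flux_range F HF b Hb)). lra.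
  - intros [_ Eb]. right. lra.
Qed.

Lemma half_riemann_out_rho_minus (F : R -> R) (HF : fundamental_diagram F) (b C : R) :
  in01 b -> 0 <= C <= flux_max F ->
  half_riemann_out F b (rho_minus F C) <-> C <= supply F b.
Proof.
  intros Hb HC. pose proof (rho_star_interior F HF) as Hs.
  destruct (rho_minus_spec F HF C HC) as [Hr E].
  unfold half_riemann_out. destruct (Rle_dec b (rho_star F)) as [Hle | Hgt].
  - rewrite supply_left by lra. split; intros _; [lra | left; lra].
  - rewrite supply_right, (tau_right F HF) by (unfold in01 in Hb; lra).
    pose proof (flux_range F HF b Hb) as HFb.
    split.
    + intros [[H _] | [_ [[_ H] | H]]]; [lra | | lra].
      apply (demand_le F HF) in H; try (apply (rho_minus_in01 F HF); assumption).
      now rewrite !demand_rho_minus in H.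
    + intros Hle. right. split; [lra |]. left. split; [lra |].
      apply Rnot_lt_le. intros H.
      pose proof (rho_minus_spec F HF _ HFb) as HrFb.
      pose proof (demand_lt F HF _ _ (rho_minus_in01 F HF _ HFb)
        (rho_minus_in01 F HF C HC) H) as Hlt.
      rewrite !demand_rho_minus in Hlt by assumption. lra.
Qed.

Lemma half_riemann_out_rho_plus (F : R -> R) (HF : fundamental_diagram F) (b C : R) :
  in01 b -> 0 <= C < flux_max F ->
  half_riemann_out F b (rho_plus F C) <-> C = supply F b /\ rho_plus F C = b.
Proof.
  intros Hb HC. pose proof (rho_star_interior F HF) as Hs.
  destruct (rho_plus_spec F HF C) as [Hr E]; [lra |].
  assert (rho_plus F C <> rho_star F)
    by (intros E'; rewrite E' in E; unfold flux_max in HC; lra).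
  unfold half_riemann_out. split.
  - intros [H0 | [Hlt [Ht | Eb]]]; [lra | |].
    + rewrite (tau_right F HF) in Ht by (unfold in01 in Hb; lra).
      pose proof (rho_minus_spec F HF _ (flux_range F HF b Hb)). lra.
    + rewrite supply_right by lra. split; [rewrite <- Eb; lra | exact Eb].
  - intros [_ Eb]. right. lra.
Qed.

(** * One road: the Godunov flux *)

Definition godunov (F : R -> R) (l r : R) : R := Rmin (demand F l) (supply F r).

(** The test is not strict: when supply and demand are equal and below capacity
    the layer is unstable, so the state is [rho_plus] and not the trace; at
    capacity it is [rho_star], which is [rho_plus] as well. *)
Definition ingoing_state (F : R -> R) (b r : R) : R :=
  if Rle_dec (supply F r) (demand F b) then rho_plus F (supply F r) else b.

Definition outgoing_state (F : R -> R) (r b : R) : R :=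
  if Rle_dec (demand F r) (supply F b) then rho_minus F (demand F r) else b.

Lemma demand_lt_max (F : R -> R) (HF : fundamental_diagram F) (b : R) :
  in01 b -> demand F b < flux_max F ->
  F b = demand F b /\ rho_minus F (demand F b) = b.
Proof.
  intros Hb. unfold demand. destruct (Rlt_dec b (rho_star F)); [| lra].
  intros _. split; [reflexivity |].
  apply (rho_minus_flux F HF). unfold in01 in Hb; lra.
Qed.

Lemma supply_lt_max (F : R -> R) (HF : fundamental_diagram F) (b : R) :
  in01 b -> supply F b < flux_max F ->
  F b = supply F b /\ rho_plus F (supply F b) = b.
Proof.
  intros Hb. unfold supply. destruct (Rle_dec b (rho_star F)); [lra |].
  intros _. split; [reflexivity |].
  apply (rho_plus_flux F HF). unfold in01 in Hb; lra.
Qed.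

(** The half-Riemann problem bounds the flux by the demand of the trace, the
    layer bounds it by the supply of the node density, and each leaves the other
    bound attained when its own is strict; so the flux is the minimum. *)
Lemma ingoing_road (F : R -> R) (HF : fundamental_diagram F) (b C K r : R) :
  in01 b ->
  layer_in F C K r /\ half_riemann_in F b K <->
  in01 r /\ C = godunov F b r /\ K = ingoing_state F b r.
Proof.
  intros Hb. rewrite (layer_in_iff F HF).
  unfold godunov, ingoing_state. split.
  - intros [[Hr [HC [[E ->] | [Hlt ->]]]] Hh];
      (split; [exact Hr |]); pose proof (supply_range F HF r Hr) as Hsr.
    + apply (half_riemann_in_rho_plus F HF) in Hh; [| assumption ..].
      rewrite Rmin_right by lra. destruct (Rle_dec (supply F r) (demand F b)); [| lra].
      rewrite E at 2. auto.
    + apply (half_riemann_in_rho_minus F HF) in Hh; [| assumption | lra].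
      destruct Hh as [E Eb].
      rewrite Rmin_left by lra. destruct (Rle_dec (supply F r) (demand F b)); [lra |].
      auto.
  - intros [Hr [-> ->]]. pose proof (supply_range F HF r Hr) as Hsr.
    pose proof (demand_range F HF b Hb) as Hdb.
    destruct (Rle_dec (supply F r) (demand F b)) as [Hle | Hgt].
    + rewrite Rmin_right by lra. split; [auto |].
      apply (half_riemann_in_rho_plus F HF); assumption.
    + rewrite Rmin_left by lra.
      destruct (demand_lt_max F HF b Hb) as [_ Eb]; [lra |].
      split.
      * split; [exact Hr |]. split; [exact Hdb |]. right. split; [lra | auto].
      * rewrite <- Eb at 2. apply (half_riemann_in_rho_minus F HF); [exact Hb | lra | auto].
Qed.

Lemma outgoing_road (F : R -> R) (HF : fundamental_diagram F) (b C K r : R) :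
  in01 b ->
  layer_out F C K r /\ half_riemann_out F b K <->
  in01 r /\ (r < 1 \/ C = 0) /\ C = godunov F r b /\ K = outgoing_state F r b.
Proof.
  intros Hb. rewrite (layer_out_iff F HF).
  unfold godunov, outgoing_state. split.
  - intros [[Hr [HC [H1 [[E ->] | [Hlt ->]]]]] Hh];
      (split; [exact Hr |]); (split; [exact H1 |]);
      pose proof (demand_range F HF r Hr) as Hdr.
    + apply (half_riemann_out_rho_minus F HF) in Hh; [| assumption ..].
      rewrite Rmin_left by lra. destruct (Rle_dec (demand F r) (supply F b)); [| lra].
      rewrite E at 2. auto.
    + apply (half_riemann_out_rho_plus F HF) in Hh; [| assumption | lra].
      destruct Hh as [E Eb].
      rewrite Rmin_right by lra. destruct (Rle_dec (demand F r) (supply F b)); [lra |].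
      auto.
  - intros [Hr [H1 [-> ->]]]. pose proof (demand_range F HF r Hr) as Hdr.
    pose proof (supply_range F HF b Hb) as Hsb.
    destruct (Rle_dec (demand F r) (supply F b)) as [Hle | Hgt].
    + rewrite Rmin_left in * by lra. split; [tauto |].
      apply (half_riemann_out_rho_minus F HF); assumption.
    + rewrite Rmin_right in * by lra.
      destruct (supply_lt_max F HF b Hb) as [_ Eb]; [lra |].
      split.
      * split; [exact Hr |]. split; [exact Hsb |]. split; [exact H1 |].
        right. split; [lra | auto].
      * rewrite <- Eb at 2. apply (half_riemann_out_rho_plus F HF); [exact Hb | lra | auto].
Qed.

(** * The junction: one scalar equation for the node density *)

Definition traces01 (B : roads) : Prop :=
  in01 (road1 B) /\ in01 (road2 B) /\ in01 (road3 B).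

Definition node_fluxes (F : R -> R) (B : roads) (r : R) : roads :=
  Roads (godunov F (road1 B) r) (godunov F (road2 B) r) (godunov F r (road3 B)).

Definition node_states (F : R -> R) (B : roads) (r : R) : roads :=
  Roads (ingoing_state F (road1 B) r) (ingoing_state F (road2 B) r)
    (outgoing_state F r (road3 B)).

Definition balanced (F : R -> R) (B : roads) (r : R) : Prop :=
  in01 r /\
  godunov F (road1 B) r + godunov F (road2 B) r = godunov F r (road3 B).

(** The restriction on the node density 1 in [outgoing_road] is harmless here:
    the supply of that density vanishes, hence so do all fluxes. *)
Lemma admissible_iff_balanced (F : R -> R) (HF : fundamental_diagram F)
    (B C K : roads) :
  traces01 B ->
  admissible F B C K <->
  exists r, balanced F B r /\ C = node_fluxes F B r /\ K = node_states F B r.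
Proof.
  intros [H1 [H2 H3]]. unfold admissible, balanced. split.
  - intros [[r1 r2 r3] [Hf [A1 [A2 A3]]]].
    unfold fair_merging in Hf. simpl in *.
    assert (E1 : r1 = r3) by lra. assert (E2 : r2 = r3) by lra. subst r1 r2.
    apply (ingoing_road F HF) in A1, A2; try assumption.
    apply (outgoing_road F HF) in A3; [| assumption].
    destruct C as [c1 c2 c3], K as [k1 k2 k3]; simpl in *.
    destruct A1 as [Hr [-> ->]], A2 as [_ [-> ->]], A3 as [_ [_ [-> ->]]].
    exists r3. repeat split; try apply Hr. symmetry; apply Hf.
  - intros [r [[Hr Hb] [-> ->]]]. exists (Roads r r r). simpl.
    split; [unfold fair_merging; simpl; lra |].
    rewrite !(ingoing_road F HF), (outgoing_road F HF) by assumption.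
    repeat split; try apply Hr.
    destruct (proj2 Hr) as [Hlt | ->]; [left; exact Hlt | right].
    rewrite <- Hb. pose proof (rho_star_interior F HF).
    unfold godunov. rewrite (supply_right F 1), (fd_one F HF) by lra.
    pose proof (demand_range F HF _ H1). pose proof (demand_range F HF _ H2).
    rewrite !Rmin_right by lra. ring.
Qed.

Lemma ingoing_state_flux (F : R -> R) (HF : fundamental_diagram F) (b r : R) :
  in01 b -> in01 r -> F (ingoing_state F b r) = godunov F b r.
Proof.
  intros Hb Hr. pose proof (supply_range F HF r Hr) as Hsr.
  unfold ingoing_state, godunov.
  destruct (Rle_dec (supply F r) (demand F b)) as [Hle | Hgt].
  - rewrite Rmin_right by lra. apply (rho_plus_spec F HF _ Hsr).
  - rewrite Rmin_left by lra. apply (demand_lt_max F HF); [exact Hb | lra].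
Qed.

Lemma outgoing_state_flux (F : R -> R) (HF : fundamental_diagram F) (b r : R) :
  in01 b -> in01 r -> F (outgoing_state F r b) = godunov F r b.
Proof.
  intros Hb Hr. pose proof (demand_range F HF r Hr) as Hdr.
  unfold outgoing_state, godunov.
  destruct (Rle_dec (demand F r) (supply F b)) as [Hle | Hgt].
  - rewrite Rmin_left by lra. apply (rho_minus_spec F HF _ Hdr).
  - rewrite Rmin_right by lra. apply (supply_lt_max F HF); [exact Hb | lra].
Qed.

Lemma godunov_antitone_right (F : R -> R) (HF : fundamental_diagram F) (b x y : R) :
  in01 x -> in01 y -> x <= y -> godunov F b y <= godunov F b x.
Proof.
  intros Hx Hy Hxy. apply Rle_min_compat_l, (supply_le F HF); assumption.
Qed.

Lemma godunov_monotone_left (F : R -> R) (HF : fundamental_diagram F) (b x y : R) :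
  in01 x -> in01 y -> x <= y -> godunov F x b <= godunov F y b.
Proof.
  intros Hx Hy Hxy. apply Rle_min_compat_r, (demand_le F HF); assumption.
Qed.

(** Between two solutions the ingoing fluxes can only drop and the outgoing flux
    can only rise; being balanced at both ends, none of them moves. *)
Lemma balanced_fluxes_unique (F : R -> R) (HF : fundamental_diagram F)
    (B : roads) (x y : R) :
  balanced F B x -> balanced F B y -> node_fluxes F B x = node_fluxes F B y.
Proof.
  assert (Hord : forall x y, x <= y -> balanced F B x -> balanced F B y ->
    node_fluxes F B x = node_fluxes F B y).
  { clear x y. intros x y Hxy [Hx Ex] [Hy Ey].
    pose proof (godunov_antitone_right F HF (road1 B) x y Hx Hy Hxy).
    pose proof (godunov_antitone_right F HF (road2 B) x y Hx Hy Hxy).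
    pose proof (godunov_monotone_left F HF (road3 B) x y Hx Hy Hxy).
    unfold node_fluxes. f_equal; lra. }
  intros Hx Hy. destruct (Rle_dec x y); [| symmetry]; apply Hord; (assumption || lra).
Qed.

(** A whole interval of node densities can carry the same fluxes only if the
    ingoing demands and the outgoing supply are all exactly used up.  The last
    two alternatives cover that situation when one road alone fills the
    capacity, because this pins the node density to [rho_star]. *)
Definition tie_free (F : R -> R) (B : roads) : Prop :=
  demand F (road1 B) + demand F (road2 B) <> supply F (road3 B) \/
  demand F (road1 B) = flux_max F \/ demand F (road2 B) = flux_max F.

Lemma supply_inj (F : R -> R) (HF : fundamental_diagram F) (x y : R) :
  in01 x -> in01 y -> supply F x = supply F y -> supply F x < flux_max F -> x = y.
Proof.
  intros Hx Hy E Hlt. destruct (supply_lt_max F HF x Hx Hlt) as [_ <-].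
  rewrite E in *. apply (supply_lt_max F HF y Hy Hlt).
Qed.

Lemma demand_inj (F : R -> R) (HF : fundamental_diagram F) (x y : R) :
  in01 x -> in01 y -> demand F x = demand F y -> demand F x < flux_max F -> x = y.
Proof.
  intros Hx Hy E Hlt. destruct (demand_lt_max F HF x Hx Hlt) as [_ <-].
  rewrite E in *. apply (demand_lt_max F HF y Hy Hlt).
Qed.

Lemma saturated_node_density (F : R -> R) (HF : fundamental_diagram F) (x : R) :
  in01 x -> supply F x = flux_max F -> demand F x = flux_max F -> x = rho_star F.
Proof.
  intros Hx Hs Hd. apply NNPP. intros Hne.
  pose proof (flux_lt_max F HF x Hx Hne).
  unfold supply, demand in *.
  destruct (Rle_dec x (rho_star F)), (Rlt_dec x (rho_star F)); lra.
Qed.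

(** The fluxes are the same at both solutions.  Without a tie, either some demand
    is not exhausted, so its flux is the supply of the node density; or the
    outgoing supply is not exhausted, so its flux is the demand of the node
    density; or the capacity is reached from both sides.  Supply and demand below
    capacity determine the density, and both at capacity give [rho_star]. *)
Lemma balanced_unique (F : R -> R) (HF : fundamental_diagram F)
    (B : roads) (x y : R) :
  traces01 B -> tie_free F B -> balanced F B x -> balanced F B y -> x = y.
Proof.
  intros [H1 [H2 H3]] Htie Hbx Hby.
  pose proof (balanced_fluxes_unique F HF B x y Hbx Hby) as E.
  destruct Hbx as [Hx Ex], Hby as [Hy Ey].
  injection E as E1 E2 E3. unfold tie_free, godunov in *.
  pose proof (supply_range F HF x Hx). pose proof (demand_range F HF x Hx).
  pose proof (supply_range F HF y Hy). pose proof (demand_range F HF y Hy).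
  pose proof (demand_range F HF _ H1). pose proof (demand_range F HF _ H2).
  pose proof (supply_range F HF _ H3).
  destruct (Req_dec (supply F x) (supply F y)) as [Es | Es].
  - destruct (Rlt_dec (supply F x) (flux_max F)) as [Hlt | Hge];
      [apply (supply_inj F HF); assumption |].
    destruct (Req_dec (demand F x) (demand F y)) as [Ed | Ed].
    + destruct (Rlt_dec (demand F x) (flux_max F)) as [Hlt' | Hge'];
        [apply (demand_inj F HF); assumption |].
      transitivity (rho_star F); [| symmetry];
        apply (saturated_node_density F HF); (assumption || lra).
    + exfalso. unfold Rmin in *. repeat destruct Rle_dec; lra.
  - destruct (Req_dec (demand F x) (demand F y)) as [Ed | Ed].
    + destruct (Rlt_dec (demand F x) (flux_max F)) as [Hlt' | Hge'];
        [apply (demand_inj F HF); assumption |].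
      exfalso. unfold Rmin in *. repeat destruct Rle_dec; lra.
    + exfalso. unfold Rmin in *. repeat destruct Rle_dec; lra.
Qed.

(** One balanced node density settles a case: the uniqueness results above are
    uniform, so only the prescribed values remain to be compared with it. *)
Lemma determined_up_to_ties_intro (F : R -> R) (HF : fundamental_diagram F)
    (B : roads) (lost multiple : Prop) (C K : roads) (r : R) :
  traces01 B -> balanced F B r -> C = node_fluxes F B r ->
  F (road1 K) = road1 C -> F (road2 K) = road2 C -> F (road3 K) = road3 C ->
  (~ lost -> K = node_states F B r) -> (~ multiple -> tie_free F B) ->
  determined_up_to_ties F B lost multiple C K.
Proof.
  intros HB Hr HC K1 K2 K3 HK Htie.
  assert (Hadm : forall K', K' = node_states F B r -> admissible F B C K').
  { intros K' ->. apply (admissible_iff_balanced F HF); [exact HB |].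
    exists r. auto. }
  repeat apply conj.
  - exists (node_states F B r). auto.
  - intros C' K' H. apply (admissible_iff_balanced F HF) in H; [| exact HB].
    destruct H as [r' [Hr' [-> ->]]].
    assert (E : node_fluxes F B r' = C)
      by (rewrite HC; apply (balanced_fluxes_unique F HF); assumption).
    split; [exact E |]. rewrite K1, K2, K3, <- E. simpl.
    destruct HB as [H1 [H2 H3]], Hr' as [Hr' _].
    rewrite !(ingoing_state_flux F HF), (outgoing_state_flux F HF) by assumption.
    auto.
  - auto.
  - intros Hl Hm C' K'. split; [| intros [-> ->]; auto].
    intros H. apply (admissible_iff_balanced F HF) in H; [| exact HB].
    destruct H as [r' [Hr' [-> ->]]].
    rewrite (balanced_unique F HF B r' r HB (Htie Hm) Hr' Hr).
    split; symmetry; auto.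
Qed.

(** * The three regimes *)

Lemma swap_ingoing_admissible (F : R -> R) (b1 b2 b3 c1 c2 c3 k1 k2 k3 : R) :
  admissible F (Roads b1 b2 b3) (Roads c1 c2 c3) (Roads k1 k2 k3) ->
  admissible F (Roads b2 b1 b3) (Roads c2 c1 c3) (Roads k2 k1 k3).
Proof.
  intros [[r1 r2 r3] [Hf [A1 [A2 A3]]]]. exists (Roads r2 r1 r3).
  unfold fair_merging in *. simpl in *.
  split; [lra |]. split; [exact A2 |]. split; [exact A1 | exact A3].
Qed.

Lemma swap_ingoing_determined_up_to_ties (F : R -> R)
    (b1 b2 b3 c1 c2 c3 k1 k2 k3 : R) (lost multiple : Prop) :
  determined_up_to_ties F (Roads b1 b2 b3) lost multiple
    (Roads c1 c2 c3) (Roads k1 k2 k3) ->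
  determined_up_to_ties F (Roads b2 b1 b3) lost multiple
    (Roads c2 c1 c3) (Roads k2 k1 k3).
Proof.
  intros [[[x1 x2 x3] Hex] [Hfl [Hadm Hdet]]]. repeat apply conj.
  - exists (Roads x2 x1 x3). apply swap_ingoing_admissible, Hex.
  - intros [d1 d2 d3] [l1 l2 l3] H.
    destruct (Hfl _ _ (swap_ingoing_admissible F _ _ _ _ _ _ _ _ _ H))
      as [E [E1 [E2 E3]]].
    injection E as -> -> ->. simpl in *. auto.
  - intros Hl. apply swap_ingoing_admissible, Hadm, Hl.
  - intros Hl Hm [d1 d2 d3] [l1 l2 l3]. split.
    + intros H. apply swap_ingoing_admissible in H.
      apply (Hdet Hl Hm) in H. destruct H as [E E'].
      injection E as -> -> ->. injection E' as -> -> ->. auto.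
    + intros [-> ->]. apply swap_ingoing_admissible, Hadm, Hl.
Qed.

(** A congested node offers full capacity, so the outgoing road takes its whole
    supply: the state is the trace, or [rho_star] if the trace is free. *)
Lemma outgoing_state_congested (F : R -> R) (HF : fundamental_diagram F) (r b : R) :
  in01 b -> rho_star F <= r ->
  outgoing_state F r b = rho_plus F (supply F b).
Proof.
  intros Hb Hr. pose proof (supply_range F HF b Hb).
  unfold outgoing_state. rewrite demand_right by exact Hr.
  destruct (Rle_dec (flux_max F) (supply F b)).
  - replace (supply F b) with (flux_max F) by lra.
    now rewrite rho_minus_max, rho_plus_max.
  - symmetry. apply (supply_lt_max F HF); [exact Hb | lra].
Qed.

(** The node is so congested that its supply is S3/2, which neither ingoing
    demand undercuts. *)
Lemma equal_split (F : R -> R) (HF : fundamental_diagram F)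
    (b1 b2 b3 : R) (multiple : Prop) :
  in01 b1 -> in01 b2 -> in01 b3 ->
  supply F b3 <= 2 * demand F b1 -> supply F b3 <= 2 * demand F b2 ->
  (~ multiple -> tie_free F (Roads b1 b2 b3)) ->
  determined_up_to_ties F (Roads b1 b2 b3) False multiple
    (Roads (supply F b3 / 2) (supply F b3 / 2) (supply F b3))
    (Roads (rho_plus F (supply F b3 / 2)) (rho_plus F (supply F b3 / 2))
       (rho_plus F (supply F b3))).
Proof.
  intros H1 H2 H3 L1 L2 Htie. pose proof (supply_range F HF b3 H3) as Hs3.
  assert (Hh : 0 <= supply F b3 / 2 <= flux_max F) by lra.
  destruct (rho_plus_spec F HF _ Hh) as [Hr Er].
  pose proof (supply_rho_plus F HF _ Hh) as Esup.
  pose proof (demand_right F _ (proj1 Hr)) as Edem.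
  apply (determined_up_to_ties_intro F HF) with (r := rho_plus F (supply F b3 / 2));
    simpl; [| | | exact Er | exact Er | | | exact Htie].
  - repeat split; simpl; (apply H1 || apply H2 || apply H3).
  - split; [apply (rho_plus_in01 F HF), Hh |]. simpl. unfold godunov.
    rewrite Esup, Edem, !Rmin_right; lra.
  - unfold node_fluxes, godunov; simpl.
    rewrite Esup, Edem, !Rmin_right by lra. reflexivity.
  - apply (rho_plus_spec F HF), Hs3.
  - intros _. unfold node_states; simpl.
    rewrite (outgoing_state_congested F HF) by (assumption || apply Hr).
    unfold ingoing_state. rewrite Esup.
    destruct (Rle_dec (supply F b3 / 2) (demand F b1)); [| lra].
    destruct (Rle_dec (supply F b3 / 2) (demand F b2)); [| lra].
    reflexivity.
Qed.

(** The node supply is S3 - D2, at least D2: road 2 sends its whole demand and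
    road 1 the rest.  If S3 = 2 D2 the layer on road 2 is no longer stable and
    the state jumps from [b2] to the congested density with the same flux; this
    is the lost tie. *)
Lemma road2_limited (F : R -> R) (HF : fundamental_diagram F)
    (b1 b2 b3 : R) (lost multiple : Prop) :
  in01 b1 -> in01 b2 -> in01 b3 ->
  2 * demand F b2 <= supply F b3 -> supply F b3 <= demand F b1 + demand F b2 ->
  (supply F b3 = 2 * demand F b2 -> lost) ->
  (~ multiple -> tie_free F (Roads b1 b2 b3)) ->
  determined_up_to_ties F (Roads b1 b2 b3) lost multiple
    (Roads (supply F b3 - demand F b2) (demand F b2) (supply F b3))
    (Roads (rho_plus F (supply F b3 - demand F b2)) b2 (rho_plus F (supply F b3))).
Proof.
  intros H1 H2 H3 L2 L12 Hlost Htie. pose proof (supply_range F HF b3 H3) as Hs3.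
  pose proof (demand_range F HF b2 H2) as Hd2. pose proof (flux_max_pos F HF).
  assert (Hh : 0 <= supply F b3 - demand F b2 <= flux_max F) by lra.
  destruct (rho_plus_spec F HF _ Hh) as [Hr Er].
  pose proof (supply_rho_plus F HF _ Hh) as Esup.
  pose proof (demand_right F _ (proj1 Hr)) as Edem.
  apply (determined_up_to_ties_intro F HF)
    with (r := rho_plus F (supply F b3 - demand F b2));
    simpl; [| | | exact Er | | | | exact Htie].
  - repeat split; simpl; (apply H1 || apply H2 || apply H3).
  - split; [apply (rho_plus_in01 F HF), Hh |]. simpl. unfold godunov.
    rewrite Esup, Edem. rewrite (Rmin_left (demand F b2)), !Rmin_right; lra.
  - unfold node_fluxes, godunov; simpl.
    rewrite Esup, Edem. rewrite (Rmin_left (demand F b2)), !Rmin_right by lra.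
    reflexivity.
  - apply (demand_lt_max F HF); [exact H2 | lra].
  - apply (rho_plus_spec F HF), Hs3.
  - intros Hnl. unfold node_states; simpl.
    rewrite (outgoing_state_congested F HF) by (assumption || apply Hr).
    unfold ingoing_state. rewrite Esup.
    destruct (Rle_dec (supply F b3 - demand F b2) (demand F b1)); [| lra].
    destruct (Rle_dec (supply F b3 - demand F b2) (demand F b2)); [| reflexivity].
    elim Hnl. apply Hlost. lra.
Qed.

Lemma road1_limited (F : R -> R) (HF : fundamental_diagram F)
    (b1 b2 b3 : R) (lost multiple : Prop) :
  in01 b1 -> in01 b2 -> in01 b3 ->
  2 * demand F b1 <= supply F b3 -> supply F b3 <= demand F b1 + demand F b2 ->
  (supply F b3 = 2 * demand F b1 -> lost) ->
  (~ multiple -> tie_free F (Roads b1 b2 b3)) ->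
  determined_up_to_ties F (Roads b1 b2 b3) lost multiple
    (Roads (demand F b1) (supply F b3 - demand F b1) (supply F b3))
    (Roads b1 (rho_plus F (supply F b3 - demand F b1)) (rho_plus F (supply F b3))).
Proof.
  intros H1 H2 H3 L1 L12 Hlost Htie. apply swap_ingoing_determined_up_to_ties.
  apply (road2_limited F HF); [assumption .. | lra | assumption |].
  intros Hm. specialize (Htie Hm). unfold tie_free in *; simpl in *.
  rewrite Rplus_comm. tauto.
Qed.

(** The node is free, at the density whose demand is D1 + D2; its supply is the
    full capacity, so the ingoing traces persist. *)
Lemma all_through (F : R -> R) (HF : fundamental_diagram F)
    (b1 b2 b3 : R) (multiple : Prop) :
  in01 b1 -> in01 b2 -> in01 b3 -> b1 <= rho_star F -> b2 <= rho_star F ->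
  demand F b1 + demand F b2 <= supply F b3 ->
  (~ multiple -> tie_free F (Roads b1 b2 b3)) ->
  determined_up_to_ties F (Roads b1 b2 b3) False multiple
    (Roads (demand F b1) (demand F b2) (demand F b1 + demand F b2))
    (Roads b1 b2 (rho_minus F (demand F b1 + demand F b2))).
Proof.
  intros H1 H2 H3 B1 B2 L12 Htie. pose proof (supply_range F HF b3 H3) as Hs3.
  pose proof (demand_range F HF b1 H1) as Hd1.
  pose proof (demand_range F HF b2 H2) as Hd2.
  assert (Hh : 0 <= demand F b1 + demand F b2 <= flux_max F) by lra.
  destruct (rho_minus_spec F HF _ Hh) as [Hr Er].
  pose proof (demand_rho_minus F HF _ Hh) as Edem.
  pose proof (supply_left F _ (proj2 Hr)) as Esup.
  assert (Hfree : forall b, in01 b -> b <= rho_star F ->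
    ingoing_state F b (rho_minus F (demand F b1 + demand F b2)) = b).
  { intros b Hb Hle. unfold ingoing_state. rewrite Esup.
    destruct (Rle_dec (flux_max F) (demand F b)) as [Hf |]; [| reflexivity].
    rewrite (rho_plus_max F HF). apply NNPP. intros Hne.
    rewrite demand_left in Hf by exact Hle.
    pose proof (flux_lt_max F HF b Hb (not_eq_sym Hne)). lra. }
  apply (determined_up_to_ties_intro F HF)
    with (r := rho_minus F (demand F b1 + demand F b2));
    simpl; [| | | | | exact Er | | exact Htie].
  - repeat split; simpl; (apply H1 || apply H2 || apply H3).
  - split; [apply (rho_minus_in01 F HF), Hh |]. simpl. unfold godunov.
    rewrite Esup, Edem, !Rmin_left; lra.
  - unfold node_fluxes, godunov; simpl.
    rewrite Esup, Edem, !Rmin_left by lra. reflexivity.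
  - now rewrite demand_left.
  - now rewrite demand_left.
  - intros _. unfold node_states; simpl. rewrite !Hfree by assumption.
    unfold outgoing_state. rewrite Edem.
    destruct (Rle_dec (demand F b1 + demand F b2) (supply F b3)); [reflexivity | lra].
Qed.

Lemma determined_of_no_ties (F : R -> R) (B C K : roads) :
  determined_up_to_ties F B False False C K -> determined F B C K.
Proof. intros [_ [_ [_ H]]]. apply H; tauto. Qed.

(** * The eight combinations of half-Riemann problems *)

Theorem theorem5p1 (F : R -> R) (HF : fundamental_diagram F)
    (b1 b2 b3 : R) (H1 : in01 b1) (H2 : in01 b2) (H3 : in01 b3) :
  let B := Roads b1 b2 b3 in
  let rs := rho_star F in
  let s := flux_max F in
  let rp := rho_plus F in
  let rm := rho_minus F in
  (* RP1-1-1 *)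
  (b1 >= rs -> b2 >= rs -> b3 <= rs ->
     determined F B (Roads (s / 2) (s / 2) s) (Roads (rp (s / 2)) (rp (s / 2)) rs)) /\
  (* RP1-1-2 *)
  (b1 >= rs -> b2 >= rs -> b3 >= rs ->
     determined F B (Roads (F b3 / 2) (F b3 / 2) (F b3))
       (Roads (rp (F b3 / 2)) (rp (F b3 / 2)) b3)) /\
  (* RP1-2-1 *)
  (b1 >= rs -> b2 <= rs -> b3 <= rs ->
     (F b2 >= s / 2 ->
        determined F B (Roads (s / 2) (s / 2) s) (Roads (rp (s / 2)) (rp (s / 2)) rs)) /\
     (F b2 <= s / 2 ->
        determined_up_to_ties F B (F b2 = s / 2) False
          (Roads (s - F b2) (F b2) s) (Roads (rp (s - F b2)) b2 rs))) /\
  (* RP2-1-1 *)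
  (b1 <= rs -> b2 >= rs -> b3 <= rs ->
     (F b1 >= s / 2 ->
        determined F B (Roads (s / 2) (s / 2) s) (Roads (rp (s / 2)) (rp (s / 2)) rs)) /\
     (F b1 <= s / 2 ->
        determined_up_to_ties F B (F b1 = s / 2) False
          (Roads (F b1) (s - F b1) s) (Roads b1 (rp (s - F b1)) rs))) /\
  (* RP1-2-2 *)
  (b1 >= rs -> b2 <= rs -> b3 >= rs ->
     (F b3 <= 2 * F b2 ->
        determined F B (Roads (F b3 / 2) (F b3 / 2) (F b3))
          (Roads (rp (F b3 / 2)) (rp (F b3 / 2)) b3)) /\
     (F b3 >= 2 * F b2 ->
        determined_up_to_ties F B (F b3 = 2 * F b2) False
          (Roads (F b3 - F b2) (F b2) (F b3)) (Roads (rp (F b3 - F b2)) b2 b3))) /\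
  (* RP2-1-2 *)
  (b1 <= rs -> b2 >= rs -> b3 >= rs ->
     (F b3 <= 2 * F b1 ->
        determined F B (Roads (F b3 / 2) (F b3 / 2) (F b3))
          (Roads (rp (F b3 / 2)) (rp (F b3 / 2)) b3)) /\
     (F b3 >= 2 * F b1 ->
        determined_up_to_ties F B (F b3 = 2 * F b1) False
          (Roads (F b1) (F b3 - F b1) (F b3)) (Roads b1 (rp (F b3 - F b1)) b3))) /\
  (* RP2-2-1 *)
  (b1 <= rs -> b2 <= rs -> b3 <= rs ->
     (F b1 + F b2 <= s ->
        determined_up_to_ties F B False (F b1 + F b2 = s)
          (Roads (F b1) (F b2) (F b1 + F b2)) (Roads b1 b2 (rm (F b1 + F b2)))) /\
     (F b1 + F b2 >= s -> F b1 >= s / 2 -> F b2 >= s / 2 ->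
        determined_up_to_ties F B False (F b1 + F b2 = s)
          (Roads (s / 2) (s / 2) s) (Roads (rp (s / 2)) (rp (s / 2)) rs)) /\
     (F b1 + F b2 >= s -> F b1 >= s / 2 -> F b2 <= s / 2 ->
        determined_up_to_ties F B (F b2 = s / 2) (F b1 + F b2 = s)
          (Roads (s - F b2) (F b2) s) (Roads (rp (s - F b2)) b2 rs)) /\
     (F b1 + F b2 >= s -> F b1 <= s / 2 -> F b2 >= s / 2 ->
        determined_up_to_ties F B (F b1 = s / 2) (F b1 + F b2 = s)
          (Roads (F b1) (s - F b1) s) (Roads b1 (rp (s - F b1)) rs))) /\
  (* RP2-2-2 *)
  (b1 <= rs -> b2 <= rs -> b3 >= rs ->
     (F b3 <= 2 * F b1 -> F b3 <= 2 * F b2 ->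
        determined_up_to_ties F B False (F b1 + F b2 = F b3)
          (Roads (F b3 / 2) (F b3 / 2) (F b3))
          (Roads (rp (F b3 / 2)) (rp (F b3 / 2)) b3)) /\
     (F b3 >= 2 * F b2 -> F b1 + F b2 >= F b3 ->
        determined_up_to_ties F B (F b3 = 2 * F b2) (F b1 + F b2 = F b3)
          (Roads (F b3 - F b2) (F b2) (F b3)) (Roads (rp (F b3 - F b2)) b2 b3)) /\
     (F b3 >= 2 * F b1 -> F b1 + F b2 >= F b3 ->
        determined_up_to_ties F B (F b3 = 2 * F b1) (F b1 + F b2 = F b3)
          (Roads (F b1) (F b3 - F b1) (F b3)) (Roads b1 (rp (F b3 - F b1)) b3)) /\
     (F b1 + F b2 <= F b3 ->
        determined_up_to_ties F B False (F b1 + F b2 = F b3)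
          (Roads (F b1) (F b2) (F b1 + F b2)) (Roads b1 b2 (rm (F b1 + F b2))))).
Proof.
  intros B rs s rp rm.
  pose proof (flux_max_pos F HF) as Hs.
  assert (Hfree : forall b, b <= rs -> demand F b = F b)
    by (intros b Hb; apply demand_left, Hb).
  assert (Hcong : forall b, b >= rs -> demand F b = s)
    by (intros b Hb; apply demand_right, Rge_le, Hb).
  assert (Hout1 : b3 <= rs -> supply F b3 = s /\ rp s = rs).
  { intros Hb. split; [apply supply_left, Hb | apply (rho_plus_max F HF)]. }
  assert (Hout2 : b3 >= rs -> supply F b3 = F b3 /\ rp (F b3) = b3).
  { intros Hb. apply Rge_le in Hb. unfold in01 in H3.
    split; [apply supply_right, Hb | apply (rho_plus_flux F HF); split; [exact Hb | lra]]. }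
  pose proof (flux_range F HF b1 H1) as HF1.
  pose proof (flux_range F HF b2 H2) as HF2.
  pose proof (flux_range F HF b3 H3) as HF3.
  fold s in HF1, HF2, HF3, Hs.
  pose proof (fun m => equal_split F HF b1 b2 b3 m H1 H2 H3) as Split.
  pose proof (fun l m => road2_limited F HF b1 b2 b3 l m H1 H2 H3) as Lim2.
  pose proof (fun l m => road1_limited F HF b1 b2 b3 l m H1 H2 H3) as Lim1.
  pose proof (fun m => all_through F HF b1 b2 b3 m H1 H2 H3) as Thru.
  unfold tie_free in Split, Lim1, Lim2, Thru. simpl in Split, Lim1, Lim2, Thru.
  fold rs s rp rm B in Split, Lim1, Lim2, Thru.
  (* Each trace has a demand or supply that its half-Riemann problem makes
     explicit; after rewriting with it, every subcase is an instance of one of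
     the regimes, whose inequalities are linear.  Ties are excluded because an
     ingoing RP1 has demand [s], and otherwise by the tie condition itself. *)
  repeat apply conj; intros Hb1 Hb2 Hb3;
    (apply Hout1 in Hb3 as [E3 EK3] || apply Hout2 in Hb3 as [E3 EK3]);
    (pose proof (Hfree b1 Hb1) as E1 || pose proof (Hcong b1 Hb1) as E1);
    (pose proof (Hfree b2 Hb2) as E2 || pose proof (Hcong b2 Hb2) as E2);
    rewrite E1, E2, E3 in Split, Lim1, Lim2, Thru;
    rewrite EK3 in Split, Lim1, Lim2;
    repeat apply conj; intros; try apply determined_of_no_ties;
    (apply Split || apply Lim2 || apply Lim1 || apply Thru); try lra;
    intros Hm; solve [right; auto | left; exact Hm].
Qed.
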